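(* Let $\mathcal{N}$ be a finite-dimensional complex $d$-locally diagonalizable nilpotent Lie algebra. Then there exists a unique (up to isomorphism) maximal solvable extension of $\mathcal{N}$, and it is isomorphic to an algebra of the type $\mathcal{R}_{\mathcal{T}}=\mathcal{N}\rtimes\mathcal{T}$, where $\mathcal{T}$ is a maximal torus on $\mathcal{N}$.
   Context: All vector spaces and algebras are finite-dimensional over $\mathbb{C}$. Unless otherwise noted, solvable algebras are assumed non-nilpotent, and nilpotent algebras are assumed not characteristically nilpotent (a Lie algebra is characteristically nilpotent if all its derivations are nilpotent). The convention $\operatorname{ad}_x(y)=[y,x]$ is used. Torus: a torus on a Lie algebra $\mathcal{L}$ is an abelian subalgebra of $\operatorname{Der}(\mathcal{L})$ consisting of semisimple (diagonalizable) endomorphisms; it is maximal if it is not strictly contained in another torus. For a maximal torus $\mathcal{T}$ on a nilpotent Lie algebra $\mathcal{N}$ and $\alpha\in\mathcal{T}^*$, put $\mathcal{N}_\alpha=\{n\in\mathcal{N} : t(n)=\alpha(t)n \ \forall t\in\mathcal{T}\}$ (root subspace) and $W=\{\alpha\in\mathcal{T}^* : \mathcal{N}_\alpha\neq0\}$ (root system), so $\mathcal{N}=\bigoplus_{\alpha\in W}\mathcal{N}_\alpha$. Nil-independence: derivations $d_1,\dots,d_s$ of $\mathcal{N}$ are nil-independent if $\sum_{i=1}^s c_id_i$ is non-nilpotent for all scalars $c_1,\dots,c_s\in\mathbb{C}$ that are not all zero. Maximal solvable extension: a solvable extension of $\mathcal{N}$ is a solvable Lie algebra $\mathcal{R}=\mathcal{N}\oplus\mathcal{Q}$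 (direct sum of vector spaces) whose nilradical is $\mathcal{N}$, with $\mathcal{Q}$ a complementary subspace. It is maximal if $\dim\mathcal{Q}$ is maximal, i.e. no solvable Lie algebra with nilradical $\mathcal{N}$ has larger dimension. $d$-locally diagonalizable: for a nilpotent Lie algebra $\mathcal{N}$ one fixes a basis in which all nil-independent derivations are simultaneously represented by upper-triangular matrices (it is assumed a priori that they have this form; in particular this applies to the operators $\operatorname{ad}_{x}|_{\mathcal{N}}$, $x\in\mathcal{Q}$, for a maximal solvable extension $\mathcal{N}\oplus\mathcal{Q}$). The diagonal of a derivation is the diagonal part of its matrix in this basis. $\mathcal{N}$ is called $d$-locally diagonalizable if: (i) the diagonals of all nil-independent derivations generate a maximal torus $\mathcal{T}$ on $\mathcal{N}$; (ii) for each root subspace $\mathcal{N}_\alpha$ with respect to $\mathcal{T}$, the restriction to $\mathcal{N}_\alpha$ followed by projection onto $\mathcal{N}_\alpha$ (along the other root subspaces) of every nil-independent derivation is diagonal; (iii) $0\notin W$. $\mathcal{R}_{\mathcal{T}}$: for a torus $\mathcal{T}$ on $\mathcal{N}$, $\mathcal{R}_{\mathcal{T}}=\mathcal{N}\rtimes\mathcal{T}$ is the solvable Lie algebra on $\mathcal{N}\oplus\mathcal{T}$ in which $\mathcal{N}$ keeps its bracket, $[n,t]=t(n)$ for $n\in\mathcal{N}$, $t\in\mathcal{T}$, and $[\mathcal{T},\mathcal{T}]=0$. *)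

(* Defs.v *)
From HB Require Import structures.
From mathcomp Require Import all_boot all_order all_algebra.

Set Implicit Arguments.
Unset Strict Implicit.
Unset Printing Implicit Defensive.

Import GRing.Theory passmx.
Local Open Scope ring_scope.

HB.mixin Record Vector_isLie (K : fieldType) L of Vector K L := {
  lie : L -> L -> L;
  lieDl : forall x y z, lie (x + y) z = lie x z + lie y z;
  lieZl : forall a x y, lie (a *: x) y = a *: lie x y;
  lieDr : forall x y z, lie x (y + z) = lie x y + lie x z;
  lieZr : forall a x y, lie x (a *: y) = a *: lie x y;
  liexx : forall x, lie x x = 0;
  lie_jacobi : forall x y z,
    lie x (lie y z) + lie y (lie z x) + lie z (lie x y) = 0
}.

#[short(type="lieAlgType")]
HB.structure Definition LieAlgebra (K : fieldType) :=
  {L of Vector K L & Vector_isLie K L}.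

Lemma lieC (K : fieldType) (L : lieAlgType K) (x y : L) :
  lie x y = - lie y x.
Proof.
apply/eqP; rewrite -addr_eq0; apply/eqP.
by have := liexx (x + y); rewrite lieDl !lieDr !liexx addr0 add0r.
Qed.

Section LieAlgebraNotions.
Variables (K : fieldType).
Implicit Types L N R : lieAlgType K.

Definition lie_iso L1 L2 : Prop :=
  exists f : {linear L1 -> L2},
    bijective f /\ {morph f : x y / lie x y >-> lie x y}.

Definition liev L (U V : {vspace L}) : {vspace L} :=
  <<[seq lie u v | u <- vbasis U, v <- vbasis V]>>%VS.

Definition lower_central L (U : {vspace L}) (k : nat) : {vspace L} :=
  iter k (fun V => liev V U) U.

Definition derived L (U : {vspace L}) (k : nat) : {vspace L} :=
  iter k (fun V => liev V V) U.

Definition nilpotent_sub L (U : {vspace L}) : Prop :=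
  exists k, lower_central U k = 0%VS.

Definition nilpotent_alg L : Prop := nilpotent_sub (fullv : {vspace L}).

Definition solvable_alg L : Prop :=
  exists k, derived (fullv : {vspace L}) k = 0%VS.

Definition lie_ideal L (I : {vspace L}) : Prop :=
  forall x y, x \in I -> lie x y \in I.

Definition is_nilradical L (I : {vspace L}) : Prop :=
  [/\ lie_ideal I, nilpotent_sub I
    & forall J, lie_ideal J -> nilpotent_sub J -> (J <= I)%VS].

Definition derivation L (d : 'End(L)) : Prop :=
  forall x y, d (lie x y) = lie (d x) y + lie x (d y).

Definition nilpotent_end L (d : 'End(L)) : Prop :=
  exists k, forall x, iter k d x = 0.

Definition characteristically_nilpotent L : Prop :=
  forall d : 'End(L), derivation d -> nilpotent_end d.

Definition nil_independent L (s : nat) (d : 'I_s -> 'End(L)) : Prop :=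
  (forall i, derivation (d i)) /\
  (forall c : 'I_s -> K, (exists i, c i != 0) ->
     ~ nilpotent_end (\sum_i c i *: d i)).

(* A derivation that belongs to some nil-independent family. *)
Definition nil_independent_der L (d : 'End(L)) : Prop :=
  exists s (f : 'I_s -> 'End(L)), nil_independent f /\ exists i, f i = d.

Definition semisimple_end L (d : 'End(L)) : Prop :=
  exists e : (\dim {:L}).-tuple L,
    basis_of {:L} e /\ is_diag_mx (mxof e e d).

Definition is_torus L (T : {vspace 'End(L)}) : Prop :=
  [/\ forall t, t \in T -> derivation t,
      forall t u, t \in T -> u \in T -> (t \o u)%VF = (u \o t)%VF
    & forall t, t \in T -> semisimple_end t].

Definition maximal_torus L (T : {vspace 'End(L)}) : Prop :=
  is_torus T /\ forall T', is_torus T' -> (T <= T')%VS -> T' = T.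

Section Roots.
Variables (L : lieAlgType K) (T : {vspace 'End(L)}).

(* T^* is the type 'Hom(subvs_of T, K^o). *)
Definition root_space (a : 'Hom(subvs_of T, K^o)) : {vspace L} :=
  (\bigcap_(t <- vbasis {:subvs_of T}) lker ((vsval t : 'End(L)) - (a t : K) *: \1%VF))%VS.

Lemma root_spaceP (a : 'Hom(subvs_of T, K^o)) (x : L) :
  reflect (forall t : subvs_of T, (vsval t : 'End(L)) x = (a t : K) *: x)
          (x \in root_space a).
Proof.
have mem_bigcap (s : seq (subvs_of T)) :
    (x \in (\bigcap_(t <- s) lker ((vsval t : 'End(L)) - (a t : K) *: \1%VF))%VS) =
    all (fun t => (vsval t : 'End(L)) x == (a t : K) *: x) s.
  elim: s => [|t s IHs]; first by rewrite big_nil memvf.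
  rewrite big_cons memv_cap IHs memv_ker /=.
  by rewrite add_lfunE opp_lfunE scale_lfunE id_lfunE subr_eq0.
rewrite /root_space mem_bigcap; apply: (iffP allP) => [H t | H t _]; last first.
  by apply/eqP.
rewrite (coord_vbasis (memvf t)) !linear_sum sum_lfunE scaler_suml.
apply: eq_bigr => i _; rewrite !linearZ /= scale_lfunE.
have /eqP -> : (vsval (vbasis {:subvs_of T})`_i : 'End(L)) x ==
               (a (vbasis {:subvs_of T})`_i : K) *: x.
  by apply: H; apply: mem_nth; rewrite size_tuple.
by rewrite scalerA.
Qed.

Definition is_root (a : 'Hom(subvs_of T, K^o)) : Prop := root_space a != 0%VS.

(* p is the projection onto the root space of a along all the others. *)
Definition is_root_proj (a : 'Hom(subvs_of T, K^o)) (p : 'End(L)) : Prop :=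
  (forall x, x \in root_space a -> p x = x) /\
  (forall b, b != a -> forall x, x \in root_space b -> p x = 0).

End Roots.

Section Triangular.
Variables (L : lieAlgType K) (e : (\dim {:L}).-tuple L).

(* The rows of mxof e e d are the coordinates of the d e_i; the matrix of d in
   the column convention is its transpose, so upper-triangularity of the latter
   is lower-triangularity (is_trig_mx) of the former. *)
Definition upper_triangular (d : 'End(L)) : Prop := is_trig_mx (mxof e e d).

Definition diagonal_part (d : 'End(L)) : 'End(L) :=
  hommx e e (diag_mx (\row_i mxof e e d i i)).

End Triangular.

Definition d_locally_diagonalizable L : Prop :=
  exists e : (\dim {:L}).-tuple L,
  [/\ basis_of {:L} e,
      forall d : 'End(L), nil_independent_der d -> upper_triangular e d
    & exists T : {vspace 'End(L)},
      [/\ maximal_torus T,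
          (* T is spanned by the diagonals; as these commute, the linear span
             is also the Lie subalgebra they generate. *)
          (forall d, nil_independent_der d -> diagonal_part e d \in T) /\
          (forall U : {vspace 'End(L)},
             (forall d, nil_independent_der d -> diagonal_part e d \in U) ->
             (T <= U)%VS),
          (* T is diagonal in e, so the e_i lying in a root space form a basis
             of it; the compressed derivation must be diagonal in that basis. *)
          forall (a : 'Hom(subvs_of T, K^o)) (p d : 'End(L)),
            is_root a -> is_root_proj a p -> nil_independent_der d ->
            forall i : 'I_(\dim {:L}), e`_i \in root_space a ->
              p (d e`_i) \in <[e`_i]>%VS
        & ~ is_root (0 : 'Hom(subvs_of T, K^o))]].

(* Solvable algebras are taken non-nilpotent. *)
Definition solvable_extension N R : Prop :=
  [/\ solvable_alg R, ~ nilpotent_alg R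
    & exists f : 'Hom(N, R),
      [/\ lker f = 0%VS, {morph f : x y / lie x y >-> lie x y}
        & is_nilradical (limg f)]].

Definition maximal_solvable_extension N R : Prop :=
  solvable_extension N R /\
  forall R', solvable_extension N R' -> (\dim {:R'} <= \dim {:R})%N.

End LieAlgebraNotions.

(* The semidirect product of N and T, with [n, t] = t(n). *)
Definition torus_ext (K : fieldType) (N : lieAlgType K)
    (T : {vspace 'End(N)}) (hT : is_torus T) : Type :=
  (N * subvs_of T)%type.

Section TorusExt.
Variables (K : fieldType) (N : lieAlgType K) (T : {vspace 'End(N)}).
Variable hT : is_torus T.

HB.instance Definition _ := Vector.on (torus_ext hT).

Definition torus_ext_lie (x y : torus_ext hT) : torus_ext hT :=
  (lie x.1 y.1 + (vsval y.2 : 'End(N)) x.1 - (vsval x.2 : 'End(N)) y.1, 0).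

Fact torus_ext_lieDl x y z :
  torus_ext_lie (x + y) z = torus_ext_lie x z + torus_ext_lie y z.
Proof.
congr pair; last by rewrite /= addr0.
by rewrite /= lieDl !linearD /= add_lfunE opprD [X in X + _ = _]addrACA [LHS]addrACA.
Qed.

Fact torus_ext_lieZl a x y :
  torus_ext_lie (a *: x) y = a *: torus_ext_lie x y.
Proof.
congr pair; last by rewrite /= scaler0.
by rewrite /= lieZl !linearZ /= scale_lfunE -scalerN -!scalerDr.
Qed.

Fact torus_ext_lieDr x y z :
  torus_ext_lie x (y + z) = torus_ext_lie x y + torus_ext_lie x z.
Proof.
congr pair; last by rewrite /= addr0.
by rewrite /= lieDr !linearD /= add_lfunE [X in X + _ = _]addrACA [LHS]addrACA.
Qed.

Fact torus_ext_lieZr a x y :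
  torus_ext_lie x (a *: y) = a *: torus_ext_lie x y.
Proof.
congr pair; last by rewrite /= scaler0.
by rewrite /= lieZr !linearZ /= scale_lfunE -!scalerDr.
Qed.

Fact torus_ext_liexx x : torus_ext_lie x x = 0.
Proof. by congr pair; rewrite /= liexx add0r subrr. Qed.

Fact torus_ext_lie_jacobi x y z :
  torus_ext_lie x (torus_ext_lie y z) + torus_ext_lie y (torus_ext_lie z x)
    + torus_ext_lie z (torus_ext_lie x y) = 0.
Proof.
have [der com _] := hT.
case: x y z => [a [s sT]] [b [t tT]] [c [u uT]].
congr pair; last by rewrite /= !addr0.
have comE (v w : 'End(N)) n : v \in T -> w \in T -> v (w n) = w (v n).
  by move=> vT wT; rewrite -!comp_lfunE com.
rewrite /= !zero_lfunE !addr0 !linearB !linearD /=.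
have lieBr (p q r : N) : lie p (q - r) = lie p q - lie p r.
  by rewrite lieDr -scaleN1r lieZr scaleN1r.
rewrite !lieBr !lieDr !(der s sT, der t tT, der u uT).
rewrite (comE u t) // (comE u s) // (comE t s) //.
rewrite (lieC (s b)) (lieC (t c)) (lieC (u a)).
rewrite !(opprB, opprD, opprK, addrA).
rewrite [LHS](ACl (1*8*15*2*19*11*3*4*17*9*5*21*6*7*13*18*10*16*12*14*20))/=.
by rewrite !addrK lie_jacobi.
Qed.

HB.instance Definition _ := Vector_isLie.Build K (torus_ext hT)
  torus_ext_lieDl torus_ext_lieZl torus_ext_lieDr torus_ext_lieZr
  torus_ext_liexx torus_ext_lie_jacobi.

End TorusExt.

(* Main.v *)
(* Since some derivation is non-nilpotent, every derivation is a linear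
   combination of non-nilpotent ones, so all of Der(N) is triangular in the fixed
   basis, with diagonals in the torus T.  Choose t0 in T with no zero eigenvalue
   on N and separating the roots.  In a solvable extension R, the elements acting
   nilpotently on N form the nilradical N, so the diagonal of ad_x|N embeds R/N
   into T; hence the semidirect product of N and T is maximal, and when R is
   maximal some ad_x|N has diagonal t0.  By condition (ii), no nonzero nilpotent
   derivation commutes with t0, so exponentials of derivations conjugate ad_x|N
   to t0 one band at a time, and one may assume ad_x|N = t0.  As t0 is invertible
   on N and [R, R] lies in N, the centralizer Q of x is a complement of N, and
   [Q, Q] lies in both Q and N, hence vanishes; Q acts on N as the centralizer of
   t0 in Der(N), which is T. *)
From HB Require Import structures.
Require Import Defs.
From mathcomp Require Import all_boot all_order all_algebra.
From mathcomp Require Import boolp zify reals complex.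

Set Implicit Arguments.
Unset Strict Implicit.
Unset Printing Implicit Defensive.

Import GRing.Theory passmx.
Local Open Scope ring_scope.

(** * Triangular endomorphisms *)

Section Flags.
Variables (K : fieldType) (V : vectType K) (n : nat) (e : n.-tuple V).
Hypothesis eB : basis_of {:V} e.
Implicit Types (d u : 'End(V)) (x : V) (i j : 'I_n) (k l : nat).

Definition flag l : {vspace V} := <<take l e>>%VS.

(* Matrix entries are taken in the row convention: the entry (i, j) of [d] is
   the coefficient of [d e_i] on [e_j]. *)
Definition entry d i j : K := coord e j (d e`_i).

(** In this row convention [band 0] means upper triangular and [band 1] strictly upper triangular; a
    larger [k] keeps the support further from the diagonal. *)
Definition band k d := forall i j, (i < j + k)%N -> entry d i j = 0.

Lemma basis_expand x : x = \sum_i coord e i x *: e`_i.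
Proof. exact: coord_basis eB (memvf x). Qed.

Lemma entry_expand d i : d e`_i = \sum_j entry d i j *: e`_j.
Proof. exact: basis_expand. Qed.

Lemma coord_basisE i j : coord e j e`_i = (i == j)%:R.
Proof. by rewrite coord_free ?(basis_free eB) // eq_sym. Qed.

Lemma coordP x y : (forall i, coord e i x = coord e i y) -> x = y.
Proof.
by move=> h; rewrite (basis_expand x) (basis_expand y); apply: eq_bigr => i _; rewrite h.
Qed.

Lemma entryP d u : (forall i j, entry d i j = entry u i j) -> d = u.
Proof.
move=> h; apply/lfunP => x; rewrite (basis_expand x) !linear_sum.
by apply: eq_bigr => i _; rewrite !linearZ; congr (_ *: _); apply: coordP => j; apply: h.
Qed.

Lemma entryD d u i j : entry (d + u) i j = entry d i j + entry u i j.
Proof. by rewrite /entry add_lfunE linearD. Qed.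

Lemma entryN d i j : entry (- d) i j = - entry d i j.
Proof. by rewrite /entry opp_lfunE linearN. Qed.

Lemma entryB d u i j : entry (d - u) i j = entry d i j - entry u i j.
Proof. by rewrite entryD entryN. Qed.

Lemma entryZ c d i j : entry (c *: d) i j = c * entry d i j.
Proof. by rewrite /entry scale_lfunE linearZ. Qed.

Lemma entry_comp d u i j :
  entry (d \o u)%VF i j = \sum_k entry u i k * entry d k j.
Proof.
rewrite /entry comp_lfunE {1}(basis_expand (u _)) !linear_sum.
by apply: eq_bigr => k _; rewrite !linearZ.
Qed.

Lemma flagP l x :
  reflect (forall j, (l <= j)%N -> coord e j x = 0) (x \in flag l).
Proof.
apply: (iffP idP) => [xl j lj | h].
  have /subvP /(_ _ xl) : (flag l <= lker (linfun (coord e j : V -> K^o)))%VS.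
    apply/span_subvP => y /(nthP 0) [m]; rewrite size_take => ms <-.
    have [ml mn] : (m < l)%N /\ (m < n)%N.
      by move: ms; rewrite size_tuple; case: (ltnP l n); lia.
    rewrite memv_ker lfunE /= nth_take //.
    rewrite -[m]/(nat_of_ord (Ordinal mn)) coord_basisE.
    by apply/eqP; case: eqP lj => [<- /=|_ _]; first lia.
  by rewrite memv_ker lfunE /= => /eqP.
rewrite (basis_expand x); apply: memv_suml => j _.
have [lj | jl] := leqP l j; first by rewrite h // scale0r mem0v.
apply: memvZ; apply: memv_span; rewrite -(nth_take _ jl).
by apply: mem_nth; rewrite size_take size_tuple; case: ifP => //; lia.
Qed.

Lemma flag0 : flag 0 = 0%VS.
Proof. by rewrite /flag take0 span_nil. Qed.

Lemma flagT l : (n <= l)%N -> flag l = fullv.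
Proof. by move=> nl; rewrite /flag take_oversize ?size_tuple // (span_basis eB). Qed.

Lemma basis_flag i : e`_i \in flag i.+1.
Proof.
by apply/flagP => j ij; rewrite coord_basisE; case: eqP ij => [->|//]; rewrite ltnn.
Qed.

(** The coordinate-free form, from which composites, iterates and inverses are handled. Truncated
    subtraction covers [l < k], where the image is zero. *)
Lemma band_flagP k d :
  band k d <-> forall l x, x \in flag l -> d x \in flag (l - k).
Proof.
split=> [bd l x /flagP xl | h i j ij].
  rewrite (basis_expand x) linear_sum; apply: memv_suml => i _.
  rewrite linearZ /=; have [li | il] := leqP l i.
    by rewrite xl // scale0r mem0v.
  by apply: memvZ; apply/flagP => j ij; apply: bd; lia.
by have /flagP := h _ _ (basis_flag i); apply; lia.
Qed.

Lemma bandS k l d : (l <= k)%N -> band k d -> band l d.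
Proof. by move=> lk bd i j ij; apply: bd; apply: leq_trans ij _; rewrite leq_add2l. Qed.

Lemma bandD k d u : band k d -> band k u -> band k (d + u).
Proof. by move=> bd bu i j ij; rewrite entryD bd // bu // addr0. Qed.

Lemma bandN k d : band k d -> band k (- d).
Proof. by move=> bd i j ij; rewrite entryN bd // oppr0. Qed.

Lemma bandB k d u : band k d -> band k u -> band k (d - u).
Proof. by move=> bd /bandN bu; apply: bandD. Qed.

Lemma bandZ k c d : band k d -> band k (c *: d).
Proof. by move=> bd i j ij; rewrite entryZ bd // mulr0. Qed.

Lemma band0 k : band k 0.
Proof. by move=> i j ij; rewrite /entry zero_lfunE linear0. Qed.

Lemma band_sum k (I : finType) (P : pred I) (F : I -> 'End(V)) :
  (forall m, P m -> band k (F m)) -> band k (\sum_(m | P m) F m).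
Proof. by move=> h; elim/big_ind: _ => //; [apply: band0 | move=> *; apply: bandD]. Qed.

Lemma band_comp k l d u : band k d -> band l u -> band (l + k) (d \o u)%VF.
Proof.
move=> /band_flagP bd /band_flagP bu; apply/band_flagP => m x xm.
by rewrite comp_lfunE subnDA; apply: bd; apply: bu.
Qed.

Lemma band_ge k d : (n <= k)%N -> band k d -> d = 0.
Proof.
move=> nk bd; apply: entryP => i j; rewrite bd; first by rewrite /entry zero_lfunE linear0.
by have := ltn_ord i; lia.
Qed.

Lemma band_iter k d m x : band k d -> iter m d x \in flag (n - m * k).
Proof.
move=> bd; elim: m => [|m IHm] /=; first by rewrite flagT ?memvf //; lia.
have -> : (n - m.+1 * k = n - m * k - k)%N by lia.
exact: (proj1 (band_flagP k d) bd).
Qed.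

Lemma band1_iter d x : band 1 d -> iter n d x = 0.
Proof. by move/(band_iter n x); rewrite muln1 subnn flag0 memv0 => /eqP. Qed.

Lemma entry_comp_diag d u i :
  band 0 d -> band 0 u -> entry (d \o u)%VF i i = entry d i i * entry u i i.
Proof.
move=> bd bu; rewrite entry_comp (bigD1 i) //= big1 ?addr0 1?mulrC // => k ki.
have [ik | ik | /val_inj ik] := ltngtP i k; last by rewrite ik eqxx in ki.
  by rewrite bu ?addn0 // mul0r.
by rewrite bd ?addn0 // mulr0.
Qed.

Lemma band1_diag d :
  band 1 d <-> band 0 d /\ forall i, entry d i i = 0.
Proof.
split=> [bd | [bd dd] i j ij].
  by split=> [|i]; [apply: bandS bd | apply: bd; rewrite addn1].
have [ltij | ltji | /val_inj ->] := ltngtP i j; last exact: dd.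
  by apply: bd; rewrite addn0.
by move: ij; rewrite addn1 ltnS leqNgt ltji.
Qed.

Lemma band_comm1 d u :
  band 0 d -> band 0 u -> band 1 ((d \o u) - (u \o d))%VF.
Proof.
move=> bd bu; apply/band1_diag; split=> [|i].
  by apply: bandB; apply: (@band_comp 0 0).
by rewrite entryB !entry_comp_diag // mulrC subrr.
Qed.

Lemma entry_iter d m i :
  band 0 d -> coord e i (iter m d e`_i) = entry d i i ^+ m.
Proof.
(* The flag is carried along because it leaves no coordinate beyond e_i, and by triangularity the
   earlier coordinates do not feed back into e_i. *)
move=> bd; suff : iter m d e`_i \in flag i.+1 /\
    coord e i (iter m d e`_i) = entry d i i ^+ m by case.
elim: m => [|m [mi IHm]] /=; first by rewrite basis_flag coord_basisE eqxx.
split.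
  by have := (proj1 (band_flagP 0 d) bd) _ _ mi; rewrite subn0.
rewrite {1}(basis_expand (iter m d _)) !linear_sum (bigD1 i) //= big1 ?addr0.
  by rewrite !linearZ /= IHm exprSr.
move=> j ji; rewrite !linearZ /=.
have [ij | ltji | /val_inj ij] := ltngtP i j; last by rewrite ij eqxx in ji.
  by rewrite (flagP _ _ mi) // mul0r.
by rewrite [coord _ _ (d _)]bd ?mulr0 // addn0.
Qed.

Lemma nilpotent_diag0 d :
  band 0 d -> (exists k, forall x, iter k d x = 0) -> forall i, entry d i i = 0.
Proof.
move=> bd [k dk] i; apply/eqP.
have /eqP : entry d i i ^+ k = 0 by rewrite -entry_iter // dk linear0.
by rewrite expf_eq0 => /andP[].
Qed.

(** Each substitution of [x = - d x] moves [x] one flag down, until it lies in [flag 0]. *)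
Lemma band1_unipotent_inj d x : band 1 d -> x + d x = 0 -> x = 0.
Proof.
move=> bd /eqP; rewrite addr_eq0 => /eqP xdx.
have h m : x \in flag (n - m).
  elim: m => [|m IHm]; first by rewrite subn0 flagT ?memvf.
  by rewrite xdx memvN subnS -subn1; apply: (proj1 (band_flagP 1 d) bd).
by apply/eqP; rewrite -memv0 -flag0 -(subnn n).
Qed.

Definition diagonal d := forall i j, i != j -> entry d i j = 0.

Lemma diagonal_app d i : diagonal d -> d e`_i = entry d i i *: e`_i.
Proof.
move=> dd; rewrite {1}(entry_expand d i) (bigD1 i) //= big1 ?addr0 // => j ji.
by rewrite dd ?scale0r // eq_sym.
Qed.

Lemma diagonal_coord d j x : diagonal d -> coord e j (d x) = entry d j j * coord e j x.
Proof.
move=> dd; rewrite {1}(basis_expand x) !linear_sum (bigD1 j) //= big1 ?addr0.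
  by rewrite !linearZ /= mulrC.
by move=> i ij; rewrite !linearZ /= [coord _ _ (d _)]dd ?mulr0.
Qed.

Lemma diagonal_band d : diagonal d -> band 0 d.
Proof.
by move=> dd i j; rewrite addn0 => ij; apply: dd; apply: contraTneq ij => ->; rewrite ltnn.
Qed.

Lemma diagonalP d u :
  diagonal d -> diagonal u -> (forall i, entry d i i = entry u i i) -> d = u.
Proof.
move=> dd du h; apply: entryP => i j.
by have [<- // | ij] := eqVneq i j; rewrite dd // du.
Qed.

End Flags.

(** * Derivations and their exponentials *)

Section LieBasics.
Variables (K : fieldType) (L : lieAlgType K).
Implicit Types (x y z : L) (U V W : {vspace L}) (d : 'End(L)).

Lemma lie0l x : lie 0 x = 0.
Proof. by rewrite -(scale0r (0 : L)) lieZl !scale0r. Qed.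

Lemma lie0r x : lie x 0 = 0.
Proof. by rewrite -(scale0r (0 : L)) lieZr !scale0r. Qed.

Lemma lieNl x y : lie (- x) y = - lie x y.
Proof. by rewrite -!scaleN1r lieZl. Qed.

Lemma lieNr x y : lie x (- y) = - lie x y.
Proof. by rewrite -!scaleN1r lieZr. Qed.

Lemma lieBl x y z : lie (x - y) z = lie x z - lie y z.
Proof. by rewrite lieDl lieNl. Qed.

Lemma lieBr x y z : lie x (y - z) = lie x y - lie x z.
Proof. by rewrite lieDr lieNr. Qed.

Lemma lie_suml I (r : seq I) (P : pred I) (F : I -> L) y :
  lie (\sum_(i <- r | P i) F i) y = \sum_(i <- r | P i) lie (F i) y.
Proof. by apply: (big_morph (lie^~ y)) => [u v|]; rewrite ?lieDl ?lie0l. Qed.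

Lemma lie_sumr I (r : seq I) (P : pred I) (F : I -> L) x :
  lie x (\sum_(i <- r | P i) F i) = \sum_(i <- r | P i) lie x (F i).
Proof. by apply: (big_morph (lie x)) => [u v|]; rewrite ?lieDr ?lie0r. Qed.

Lemma mem_liev U V x y : x \in U -> y \in V -> lie x y \in liev U V.
Proof.
move=> xU yV; rewrite (coord_vbasis xU) (coord_vbasis yV) lie_suml.
apply: memv_suml => i _; rewrite lie_sumr; apply: memv_suml => j _.
rewrite lieZl lieZr; do 2!apply: memvZ; apply: memv_span.
by apply/allpairsP; exists ((vbasis U)`_i, (vbasis V)`_j); split => //=;
  apply: mem_nth; rewrite size_tuple.
Qed.

Lemma liev_sub U V W :
  (forall x y, x \in U -> y \in V -> lie x y \in W) -> (liev U V <= W)%VS.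
Proof.
move=> h; apply/span_subvP => z /allpairsP [[x y] /= [xU yV ->]].
by apply: h; apply: vbasis_mem.
Qed.

Lemma derivationD d u : derivation d -> derivation u -> derivation (d + u).
Proof. by move=> hd hu x y; rewrite !add_lfunE hd hu lieDl lieDr addrACA. Qed.

Lemma derivationZ c d : derivation d -> derivation (c *: d).
Proof. by move=> hd x y; rewrite !scale_lfunE hd lieZl lieZr scalerDr. Qed.

Lemma derivation0 : derivation (0 : 'End(L)).
Proof. by move=> x y; rewrite !zero_lfunE lie0l lie0r addr0. Qed.

Lemma derivationB d u : derivation d -> derivation u -> derivation (d - u).
Proof. by move=> hd hu; rewrite -scaleN1r; apply/derivationD/derivationZ. Qed.

Lemma derivation_comm d u :
  derivation d -> derivation u -> derivation ((d \o u) - (u \o d))%VF.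
Proof.
move=> hd hu x y; rewrite !add_lfunE !opp_lfunE !comp_lfunE hu hd !linearD /=.
rewrite !hd !hu lieBl lieBr !opprD !addrA.
by rewrite [LHS](ACl (1*5*4*8*(2*7)*(3*6))) /= !subrr !addr0.
Qed.

(* The action of [x] in the paper's convention ad_x(y) = [y, x]. *)
Definition adr_fun x y : L := lie y x.
Fact adr_fun_is_linear x : linear (adr_fun x).
Proof. by move=> c y z; rewrite /adr_fun lieDl lieZl. Qed.
HB.instance Definition _ x := GRing.isSemilinear.Build K L L _ (adr_fun x)
  (GRing.semilinear_linear (adr_fun_is_linear x)).
Definition adr x : 'End(L) := linfun (adr_fun x).

Lemma adrE x y : adr x y = lie y x.
Proof. by rewrite lfunE. Qed.

Lemma adr_derivation x : derivation (adr x).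
Proof.
move=> y z; rewrite !adrE; have := lie_jacobi x y z.
rewrite (lieC x (lie y z)) (lieC y (lie z x)) (lieC x y) lieNr (lieC z (lie y x)) opprK.
by move/eqP; rewrite -addrA addrC subr_eq0 eq_sym addrC => /eqP.
Qed.

(** Injectivity suffices for an automorphism, the dimension being finite. *)
Definition lie_aut d := lker d == 0%VS /\ {morph d : x y / lie x y}.

End LieBasics.

(** Among the subspaces contained in [P], one of maximal dimension absorbs every [x] satisfying [P].
    This opens dimension arguments for, say, the derivations in a given band. *)
Lemma pred_vspace (K : fieldType) (V : vectType K) (P : V -> Prop) :
  P 0 -> (forall c x y, P x -> P y -> P (c *: x + y)) ->
  exists U : {vspace V}, forall x, x \in U <-> P x.
Proof.
move=> P0 PD.
pose Q m := `[< exists2 U : {vspace V}, \dim U = m & forall x, x \in U -> P x >].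
have exQ : exists m, Q m.
  exists 0%N; apply/asboolP; exists 0%VS; rewrite ?dimv0 // => x.
  by rewrite memv0 => /eqP ->.
have ubQ m : Q m -> (m <= \dim {:V})%N.
  by move/asboolP => [U <- _]; apply/dimvS/subvf.
case: (ex_maxnP exQ ubQ) => m /asboolP [U dU UP] maxU.
exists U => x; split=> [/UP // | Px].
have: Q (\dim (<[x]> + U)).
  apply/asboolP; exists (<[x]> + U)%VS => // y.
  by move=> /memv_addP [u /vlineP [c ->] [v vU ->]]; apply: PD => //; apply: UP.
move/maxU; rewrite -dU => le_dim.
have /eqP -> : U == (<[x]> + U)%VS by rewrite eqEdim addvSr le_dim.
by rewrite memvE addvSl.
Qed.

Lemma sum_antidiagonal (V : zmodType) (F : nat -> nat -> V) M :
  \sum_(k < M) \sum_(i < k.+1) F i (k - i)%N = \sum_(i < M) \sum_(j < M - i) F i j.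
Proof.
elim: M => [|M IHM]; first by rewrite !big_ord0.
rewrite !big_ord_recr /= IHM subnn subSnn big_ord1 addrA; congr (_ + _).
rewrite -big_split /=; apply: eq_bigr => i _.
by rewrite subSn ?big_ord_recr //= ltnW.
Qed.

Section Exponential.
Variables (K : fieldType) (L : lieAlgType K).
Hypothesis K0 : [pchar K] =i pred0.
Variable m : 'End(L).
Hypothesis dm : derivation m.

(** The divided power m^j / j!, a term of the exponential series. *)
Definition divpow j x : L := j`!%:R^-1 *: iter j m x.

Lemma natr_neq0 j : (j.+1%:R : K) != 0.
Proof. by rewrite ((pcharf0P K).1 K0). Qed.

Lemma divpowS j x : j.+1%:R *: divpow j.+1 x = m (divpow j x).
Proof.
rewrite /divpow scalerA [RHS]linearZ /= factS natrM invfM mulrA mulfV ?mul1r //.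
exact: natr_neq0.
Qed.

(** Leibniz rule, by applying [m] to the case [k]: the term of index [i] receives weight [i] from
    one side and [k.+1 - i] from the other, and the total [k.+1] cancels in characteristic zero. *)
Lemma divpow_lie k x y :
  divpow k (lie x y) = \sum_(i < k.+1) lie (divpow i x) (divpow (k - i) y).
Proof.
elim: k => [|k IHk]; first by rewrite big_ord1 /divpow /= fact0 invr1 !scale1r.
apply: (scalerI (natr_neq0 k)); rewrite divpowS IHk linear_sum /=.
under eq_bigr => i _.
  rewrite dm -!divpowS (lieZl i.+1%:R) (lieZr (k - i).+1%:R); over.
rewrite big_split /= scaler_sumr.
pose G (i : nat) := lie (divpow i x) (divpow (k.+1 - i) y).
transitivity (\sum_(i < k.+2) (i%:R *: G i + (k.+1 - i)%:R *: G i)); last first.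
  apply: eq_bigr => i _; by rewrite -scalerDl -natrD subnKC // -ltnS.
rewrite big_split /=; congr (_ + _).
  rewrite [RHS]big_ord_recl /= scale0r add0r; apply: eq_bigr => i _.
  by rewrite /G /bump /= add1n subSS.
rewrite [RHS]big_ord_recr /= subnn scale0r addr0; apply: eq_bigr => i _.
by rewrite /G subSn // -ltnS.
Qed.

Variable n : nat.
Hypothesis mn : forall x, iter n m x = 0.

Lemma divpow_ge j x : (n <= j)%N -> divpow j x = 0.
Proof.
move=> nj; rewrite /divpow -[in iter _ _ _](subnK nj) iterD mn.
have -> : iter (j - n) m 0 = 0 by elim: (j - n)%N => //= l ->; rewrite linear0.
by rewrite scaler0.
Qed.

Lemma exp_lie x y :
  \sum_(k < n) divpow k (lie x y) =
  lie (\sum_(i < n) divpow i x) (\sum_(j < n) divpow j y).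
Proof.
pose F i j := lie (divpow i x) (divpow j y).
have widen M (G : nat -> L) : (n <= M)%N -> (forall j, (n <= j)%N -> G j = 0) ->
    \sum_(j < n) G j = \sum_(j < M) G j.
  move=> nM G0; rewrite (big_ord_widen _ G nM) [RHS](bigID (fun j : 'I_M => (j < n)%N)) /=.
  by rewrite [X in _ + X]big1 ?addr0 // => j; rewrite -leqNgt => /G0.
(* Up to [n + n], the triangle of antidiagonals contains the square [i, j < n]; all terms outside
   that square vanish. *)
rewrite (widen (n + n)%N (fun k => divpow k (lie x y))) ?leq_addr //; last first.
  by move=> j; apply: divpow_ge.
under eq_bigr => k _ do rewrite divpow_lie.
rewrite (sum_antidiagonal F) lie_suml.
rewrite (widen (n + n)%N (fun i => lie (divpow i x) (\sum_(j < n) divpow j y))) ?leq_addr //.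
  apply: eq_bigr => i _; rewrite lie_sumr.
  have [ni | lin] := leqP n i.
    by rewrite !big1 // => j _; rewrite /F divpow_ge ?lie0l.
  symmetry; apply: (widen (n + n - i)%N (F i)); first by lia.
  by move=> j nj; rewrite /F (divpow_ge y) ?lie0r.
by move=> j nj; rewrite divpow_ge ?lie0l.
Qed.

End Exponential.

(** * Conjugation to a diagonal derivation *)

Section Automorphisms.
Variables (K : fieldType) (L : lieAlgType K).
Implicit Types (f g : 'End(L)).

Lemma lie_aut_inv f : lie_aut f -> lie_aut (f^-1)%VF.
Proof.
move=> [k0 fM]; have fK := lker0_lfunK k0; have fVK := lker0_lfunVK k0.
split=> [|x y]; first by apply/lker0P/(can_inj fVK).
by rewrite -[in LHS](fVK x) -[in LHS](fVK y) -fM fK.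
Qed.

Lemma lie_aut_comp f g : lie_aut f -> lie_aut g -> lie_aut (f \o g)%VF.
Proof.
move=> [/lker0P f0 fM] [/lker0P g0 gM]; split=> [|x y]; last by rewrite !comp_lfunE gM fM.
by apply/lker0P => x y; rewrite !comp_lfunE => /f0 /g0.
Qed.

Lemma derivation_conj f d :
  lie_aut f -> derivation d -> derivation (f \o d \o f^-1)%VF.
Proof.
move=> fA dd x y; have [_ fVM] := lie_aut_inv fA; have [k0 fM] := fA.
by rewrite !comp_lfunE fVM dd linearD /= !fM !(lker0_lfunVK k0).
Qed.

Lemma lie_aut1 : lie_aut (\1%VF : 'End(L)).
Proof. by split=> [|x y]; [apply/lker0P => x y|]; rewrite !id_lfunE. Qed.

End Automorphisms.

Section Conjugation.
Variables (K : fieldType) (L : lieAlgType K) (n : nat) (e : n.-tuple L).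
Hypothesis K0 : [pchar K] =i pred0.
Hypothesis eB : basis_of {:L} e.
Implicit Types (d m : 'End(L)) (k : nat).

(** By equality of dimensions an injective [d] maps each flag onto itself, so its inverse preserves
    the flags too. *)
Lemma band_inv d : lker d == 0%VS -> band e 0 d -> band e 0 (d^-1)%VF.
Proof.
move=> k0 /(band_flagP eB) bd; apply/(band_flagP eB) => l x; rewrite subn0 => xl.
have le : (d @: flag e l <= flag e l)%VS.
  by apply/subvP => _ /memv_imgP [y yl ->]; rewrite -(subn0 l); apply: bd.
have /eqP eq_l : (d @: flag e l)%VS == flag e l.
  by rewrite eqEdim le /= limg_dim_eq // (eqP k0) capv0.
by move: xl; rewrite -{1}eq_l => /memv_imgP [y yl ->]; rewrite lker0_lfunK.
Qed.

Definition lpow m j : 'End(L) := iter j (comp_lfun m) \1%VF.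

Lemma lpowE m j x : lpow m j x = iter j m x.
Proof. by elim: j => [|j IHj] /=; rewrite ?id_lfunE // comp_lfunE IHj. Qed.

Lemma band_lpow k m j : band e k m -> band e (j * k) (lpow m j).
Proof.
move=> bm; elim: j => [|j IHj]; last by rewrite mulSn addnC; apply: band_comp.
by apply/(band_flagP eB) => l x; rewrite id_lfunE subn0.
Qed.

Lemma exp_aut k m : (0 < k)%N -> derivation m -> band e k m ->
  exists2 f : 'End(L), lie_aut f & band e (k + k) (f - \1%VF - m).
Proof.
move=> k0 dm bm.
have b1 : band e 1 m by apply: bandS bm.
(* This is exp m: m^n is already zero, and the two extra terms let 1 + m be split off for every [n].
   The rest starts at m^2, hence lies in band [k + k]. *)
pose f := \sum_(j < n.+2) (j`!%:R^-1 : K) *: lpow m j.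
have fE x : f x = \sum_(j < n.+2) divpow m j x.
  by rewrite sum_lfunE; apply: eq_bigr => j _; rewrite scale_lfunE lpowE.
have bf : band e (k + k) (f - \1%VF - m).
  pose r := \sum_(j < n) (j.+2`!%:R^-1 : K) *: lpow m j.+2.
  have -> : f = \1%VF + (m + r).
    rewrite /f 2!big_ord_recl !invr1 !scale1r; congr (_ + (_ + _)).
    exact: comp_lfun1r.
  rewrite [\1%VF + _]addrC addrK addrC addKr.
  apply: band_sum => j _; apply: bandZ.
  by apply: (@bandS _ _ _ _ (j.+2 * k)%N); [rewrite !mulSn; lia | apply: band_lpow].
exists f => //; split; last first.
  move=> x y; rewrite !fE; apply: exp_lie => // z.
  by rewrite -addn2 addnC iterD (band1_iter eB z b1) /= !linear0.
apply/lker0P => x y /eqP; rewrite -subr_eq0 -linearB /= => /eqP fxy.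
apply/eqP; rewrite -subr_eq0; apply/eqP.
apply: (@band1_unipotent_inj _ _ _ _ eB (f - \1%VF)); last first.
  by rewrite add_lfunE opp_lfunE id_lfunE fxy add0r subrr.
by rewrite -(subrK m (f - _)); apply: bandD => //; apply: bandS bf; lia.
Qed.

Variable t0 : 'End(L).
Hypothesis t0D : derivation t0.
Hypothesis t0d : diagonal e t0.
Hypothesis t0sep : forall d, derivation d -> forall i j, i != j ->
  entry e t0 i i = entry e t0 j j -> entry e d i j = 0.

(** An entry of the commutator is that of [m] times a difference of eigenvalues of [t0]. Where these
    differ, [m] has entry zero; where they agree, [t0sep] applies off the diagonal and the band on
    it. *)
Lemma ad_inj k m : (0 < k)%N -> derivation m -> band e k m ->
  ((t0 \o m) - (m \o t0))%VF = 0 -> m = 0.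
Proof.
move=> k0 dm bm com; apply: (entryP eB) => i j.
rewrite [RHS]/entry zero_lfunE linear0.
have [-> | ij] := eqVneq i j; first by apply: bm; lia.
have [/t0sep -> // | tij] := eqVneq (entry e t0 i i) (entry e t0 j j).
have : entry e ((t0 \o m) - (m \o t0))%VF i j = 0.
  by rewrite com /entry zero_lfunE linear0.
rewrite entryB /entry !comp_lfunE (diagonal_coord eB j _ t0d) (diagonal_app eB i t0d).
rewrite !linearZ /= -mulrBl => /eqP; rewrite mulf_eq0 subr_eq0 eq_sym (negPf tij).
by move/eqP.
Qed.

Fact ad_is_linear : linear (fun m : 'End(L) => (t0 \o m) - (m \o t0))%VF.
Proof.
move=> c x y; rewrite comp_lfunDr comp_lfunDl -comp_lfunZl -comp_lfunZr.
by rewrite scalerBr opprD addrACA.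
Qed.

(** The commutator with [t0] maps the finite-dimensional space of derivations in band [k] into
    itself, injectively, hence onto. *)
Lemma ad_surj k d : (0 < k)%N -> derivation d -> band e k d ->
  exists m, [/\ derivation m, band e k m & ((t0 \o m) - (m \o t0))%VF = d].
Proof.
move=> k0 dd bd.
have [||F FP] := @pred_vspace _ _ (fun m => derivation m /\ band e k m).
- by split; [apply: derivation0 | apply: band0].
- move=> c x y [dx bx] [dy by_]; split.
    exact/derivationD/dy/derivationZ.
  exact/bandD/by_/bandZ.
have [A AE] : exists A : 'End('End(L)), forall m, A m = ((t0 \o m) - (m \o t0))%VF.
  pose aux := GRing.isLinear.Build _ _ _ _ _ ad_is_linear.
  pose A0 : {linear _ -> _} := HB.pack (fun m : 'End(L) => (t0 \o m) - (m \o t0))%VF aux.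
  by exists (linfun A0) => m; rewrite lfunE.
have AF : (A @: F <= F)%VS.
  apply/subvP => _ /memv_imgP [m /FP [dm bm] ->]; apply/FP; rewrite AE; split.
    exact: derivation_comm.
  have bt := diagonal_band t0d.
  by apply: bandB; [rewrite -(addn0 k) | rewrite -(add0n k)]; apply: band_comp.
have A0 : (F :&: lker A = 0)%VS.
  apply/eqP; rewrite -subv0; apply/subvP => m; rewrite memv_cap memv_ker AE memv0.
  by move=> /andP [/FP [dm bm] /eqP /(ad_inj k0 dm bm) ->].
have /eqP AFF : (A @: F)%VS == F by rewrite eqEdim AF /= limg_dim_eq.
have : d \in F by apply/FP.
by rewrite -AFF => /memv_imgP [m /FP [dm bm] ->]; exists m; rewrite AE.
Qed.

(** Solve [t0, m] = d - t0 and conjugate by exp m: the first-order terms cancel, and what is left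
    lies in band [k + k]. *)
Lemma band_conj_step k d : (0 < k)%N -> derivation d -> band e k (d - t0) ->
  exists2 f : 'End(L), lie_aut f & band e k.+1 ((f \o d \o f^-1)%VF - t0).
Proof.
move=> k0 dd bd.
have [|m [dm bm mE]] := ad_surj k0 _ bd; first exact: derivationB.
have [f fA bf] := exp_aut k0 dm bm; exists f => //.
have [kf _] := fA.
set r := f - \1%VF - m in bf; have fE : f = \1%VF + m + r.
  by rewrite /r -[f - _ - m]addrA -opprD addrC addNKr.
have bt := diagonal_band t0d.
set u := d - t0 in bd mE; have dE : d = t0 + u by rewrite addrC subrK.
have key : ((f \o d) - (t0 \o f))%VF = ((m \o u) + (r \o t0) - (t0 \o r) + (r \o u))%VF.
  clearbody r u; apply/lfunP => x.
  have := congr1 (fun g : 'End(L) => g x) mE; rewrite dE fE.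
  rewrite !(add_lfunE, opp_lfunE, comp_lfunE, id_lfunE) => <-.
  rewrite !linearD /=.
  rewrite !addrA [LHS](ACl ((1*10)*(2*11)*(3*4)*5*6*7*12*8*9)) /=.
  by rewrite !subrr addNr !add0r.
have -> : ((f \o d \o f^-1) - t0)%VF = (((f \o d) - (t0 \o f)) \o f^-1)%VF.
  by rewrite comp_lfunDl comp_lfunNl -(comp_lfunA t0) lker0_compfV // comp_lfun1r.
have bf0 : band e 0 f.
  rewrite fE; apply: bandD; last by apply: bandS bf.
  apply: bandD; last by apply: bandS bm.
  by apply/(band_flagP eB) => l x; rewrite id_lfunE subn0.
rewrite -[k.+1]add0n; apply: band_comp => //; last exact: band_inv.
apply: (@bandS _ _ _ _ (k + k)); first by lia.
rewrite key; apply: bandD; first apply: bandB; first apply: bandD.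
- exact: band_comp.
- by rewrite -[(k + k)%N]add0n; apply: band_comp.
- by rewrite -[(k + k)%N]addn0; apply: band_comp.
by apply: (@bandS _ _ _ _ (k + (k + k))); [lia | apply: band_comp].
Qed.

Lemma diag_conj k d : (0 < k)%N -> derivation d -> band e k (d - t0) ->
  exists2 f : 'End(L), lie_aut f & (f \o d)%VF = (t0 \o f)%VF.
Proof.
(* Induction on [n - k]: each conjugation raises the band, and band [n] contains only zero. *)
have [p] := ubnP (n - k)%N; elim: p k d => [//|p IHp] k d np k0 dd bd.
have [nk | kn] := leqP n k.
  exists \1%VF; first exact: lie_aut1.
  have /eqP := band_ge eB nk bd; rewrite subr_eq0 => /eqP ->.
  by rewrite comp_lfun1l comp_lfun1r.
have [f fA bf] := band_conj_step k0 dd bd.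
have [|g gA gE] := IHp k.+1 _ _ isT (derivation_conj fA dd) bf.
  by lia.
exists (g \o f)%VF; first exact: lie_aut_comp.
have [kf _] := fA.
by rewrite comp_lfunA -gE -!comp_lfunA lker0_compVf ?comp_lfun1r.
Qed.

End Conjugation.

(** * Non-nilpotent derivations *)

Section Char0.
Variable K : fieldType.
Hypothesis K0 : [pchar K] =i pred0.

Lemma natr_inj_char0 : injective (fun m : nat => m%:R : K).
Proof.
have aux m p : (m <= p)%N -> m%:R = p%:R :> K -> m = p.
  move=> mp /eqP; rewrite eq_sym -subr_eq0 -natrB // ((pcharf0P K).1 K0); lia.
move=> m p mp; case: (leqP m p) => [le | /ltnW le]; first exact: aux.
by symmetry; apply: aux.
Qed.

(** In characteristic zero the scalars 1, ..., [size p] are nonzero and distinct, too many to be all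
    roots. *)
Lemma poly_nonroot (p : {poly K}) : p != 0 -> exists2 c, c != 0 & p.[c] != 0.
Proof.
move=> p0; apply: contrapT => nex.
pose rs := [seq m.+1%:R : K | m <- iota 0 (size p)].
suff : (size rs < size p)%N by rewrite size_map size_iota ltnn.
apply: max_poly_roots p0 _ _; last first.
  by rewrite map_inj_uniq ?iota_uniq // => m q /natr_inj_char0 [].
apply/allP => _ /mapP [m _ ->]; apply/rootP/eqP/negPn/negP => pm.
by apply: nex; exists m.+1%:R => //; apply: natr_neq0.
Qed.

(** If [t] is good for the earlier forms and [s] for the new one, then [t + c *: s] is good for all
    of them once [c] avoids the roots of a nonzero product of affine polynomials. *)
Lemma avoid_hyperplanes (V : vectType K) (T : {vspace V}) (I : finType)
    (P : I -> Prop) (f : I -> V -> K) :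
  (forall i t c s, f i (t + c *: s) = f i t + c * f i s) ->
  (forall i, P i -> exists2 t, t \in T & f i t != 0) ->
  exists2 t, t \in T & forall i, P i -> f i t != 0.
Proof.
move=> fD fT; suff [t tT h] : exists2 t, t \in T &
    forall i, i \in enum I -> P i -> f i t != 0.
  by exists t => // i; apply: h; rewrite mem_enum.
elim: (enum I) => [|a r [t tT h]]; first by exists 0; rewrite ?mem0v.
have [/fT [s sT fs] | nPa] := pselect (P a); last first.
  by exists t => // i; rewrite inE => /predU1P [-> // | /h].
pose q i := (f i t)%:P + f i s *: 'X.
pose Q := \prod_(i <- a :: r | `[< P i >]) q i.
have qE i c : (q i).[c] = f i (t + c *: s) by rewrite /q !hornerE fD mulrC.
have q0 i x : f i x != 0 -> (x = t) \/ (x = s) -> q i != 0.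
  move=> fx [xE | xE]; apply: contraNneq fx => qi0; rewrite xE.
    by have := congr1 (fun p : {poly K} => p`_0) qi0;
      rewrite /q coefD coefC coefZ coefX mulr0 addr0 coef0 => ->.
  by have := congr1 (fun p : {poly K} => p`_1) qi0;
    rewrite /q coefD coefC coefZ coefX mulr1 coef0 add0r => ->.
have Q0 : Q != 0.
  rewrite prodf_seq_neq0; apply/allP => i; rewrite inE => ir.
  apply/implyP => /asboolP Pi; case/predU1P: ir => [-> | ir].
    by apply: q0 fs _; right.
  by apply: (q0 i t); [apply: h | left].
have [c _ Qc] := poly_nonroot Q0.
exists (t + c *: s); first by apply: memvD => //; apply: memvZ.
move=> i ir Pi; rewrite -qE; move: Qc; rewrite /Q horner_prod prodf_seq_neq0.
by move/allP/(_ i ir)/implyP; apply; apply/asboolP.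
Qed.

Section Nilpotency.
Variables (L : lieAlgType K).
Notation n := (\dim {:L}).
Implicit Types d : 'End(L).

(** The images of the powers of [d] shrink strictly until they stabilize, and the stable image is
    zero. The uniform exponent turns nilpotency into polynomial equations. *)
Lemma nilpotent_end_dim d : nilpotent_end d -> forall x, iter n d x = 0.
Proof.
move=> [k dk].
pose W j := iter j (fun U => (d @: U)%VS) {:L}%VS.
have WP j x : x \in W j -> exists y, x = iter j d y.
  elim: j x => [|j IHj] x /=; first by exists x.
  by move=> /memv_imgP [y /IHj [z ->] ->]; exists z.
have mW j x : iter j d x \in W j.
  by elim: j => [|j IHj] /=; [apply: memvf | apply: memv_img].
have WS j : (W j.+1 <= W j)%VS.
  by elim: j => [|j IHj]; [apply: subvf | apply: limgS].
have dimW j : (\dim (W j) <= n - j)%N.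
  elim: j => [|j IHj]; first by rewrite subn0.
  have [lt | ge] := ltnP (\dim (W j.+1)) (\dim (W j)); first by lia.
  have /eqP eqW : W j.+1 == W j by rewrite eqEdim WS.
  have st l : W (l + j)%N = W j.
    by elim: l => // l IHl; rewrite -[RHS]eqW addSn /= IHl.
  have W0 : W j = 0%VS.
    apply/eqP; rewrite -subv0; apply/subvP => x; rewrite -(st k) addnC => /WP [y ->].
    by rewrite addnC iterD dk mem0v.
  by rewrite eqW W0 dimv0.
move=> x; have := mW n x; suff -> : W n = 0%VS by rewrite memv0 => /eqP.
by apply/eqP; rewrite -dimv_eq0 -leqn0 (leq_trans (dimW n)) // subnn.
Qed.

Lemma iter_pencil_poly (e : n.-tuple L) (eB : basis_of {:L} e) d0 d k x :
  exists p : 'I_n -> {poly K},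
    forall c i, (p i).[c] = coord e i (iter k (d0 + c *: d) x).
Proof.
elim: k => [|k [p pE]]; first by exists (fun i => (coord e i x)%:P) => c i; rewrite hornerC.
exists (fun j => \sum_i p i * ((entry e d0 i j)%:P + entry e d i j *: 'X)) => c j /=.
rewrite {1}(basis_expand eB (iter k (d0 + c *: d) x)) !linear_sum horner_sum.
apply: eq_bigr => i _; rewrite !hornerE pE !linearZ /=; congr (_ * _).
by rewrite -/(entry e _ i j) entryD entryZ mulrC.
Qed.

(** Were [d0 + c *: d] nilpotent for all nonzero [c], the coordinates of its [n]-th iterates,
    polynomial in [c], would vanish identically, also at [c = 0]. *)
Lemma pencil_nonnilpotent d0 d : ~ nilpotent_end d0 ->
  exists2 c, c != 0 & ~ nilpotent_end (d0 + c *: d).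
Proof.
move=> nd0; apply: contrapT => nex; apply: nd0; exists n => x.
have eB := vbasisP {:L}; apply: (coordP eB) => i; rewrite linear0.
have [p pE] := iter_pencil_poly eB d0 d n x.
rewrite -[d0]addr0 -(scale0r d) -pE.
have [-> | /poly_nonroot [c c0]] := eqVneq (p i) 0; first by rewrite horner0.
rewrite pE nilpotent_end_dim ?linear0 ?eqxx //.
by apply: contrapT => nc; apply: nex; exists c.
Qed.

(* Every derivation is a combination of two non-nilpotent ones, so linear
   conditions on non-nilpotent derivations hold for all of them. *)
Lemma derivation_split d0 d :
  derivation d0 -> ~ nilpotent_end d0 -> derivation d ->
  exists (c : K) (u : 'End(L)),
    [/\ derivation u, ~ nilpotent_end u & d = c *: (u - d0)].
Proof.
move=> dd0 nd0 dd; have [c c0 nc] := pencil_nonnilpotent d nd0.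
exists c^-1, (d0 + c *: d); split=> //.
  exact/derivationD/derivationZ.
by rewrite [d0 + _]addrC addrK scalerA mulVf // scale1r.
Qed.

Lemma nonnilpotent_nil_independent d :
  derivation d -> ~ nilpotent_end d -> nil_independent_der d.
Proof.
move=> dd nd; exists 1%N, (fun=> d); split; last by exists ord0.
split=> [// | c [i ci]]; rewrite big_ord1 => -[k dk]; apply: nd; exists k => x.
have itZ j y : iter j (c ord0 *: d) y = c ord0 ^+ j *: iter j d y.
  elim: j => [|j IHj] /=; first by rewrite scale1r.
  by rewrite IHj scale_lfunE linearZ scalerA exprS.
have /eqP := dk x; rewrite itZ scaler_eq0 expf_eq0 => /orP [/andP [_] | /eqP //].
by rewrite [ord0]ord1 -(ord1 i) (negPf ci).
Qed.

End Nilpotency.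
End Char0.

(** * The torus of a d-locally diagonalizable algebra *)

(* What the proof uses of d-local diagonalizability, stated for all derivations
   rather than for the nil-independent ones only. *)
Record triangular_torus (K : fieldType) (L : lieAlgType K) (n : nat)
    (e : n.-tuple L) (T : {vspace 'End(L)}) : Prop := TriangularTorus {
  tt_basis : basis_of {:L} e;
  tt_torus : is_torus T;
  tt_band : forall d, derivation d -> band e 0 d;
  tt_diagonal : forall t, t \in T -> diagonal e t;
  tt_diag : forall d, derivation d ->
    exists2 t, t \in T & forall i, entry e t i i = entry e d i i;
  tt_off : forall d, derivation d -> forall i j, i != j ->
    (forall t, t \in T -> entry e t i i = entry e t j j) -> entry e d i j = 0;
  tt_root0 : forall i, exists2 t, t \in T & entry e t i i != 0
}.

Section DiagonalTorus.
Variables (K : fieldType) (L : lieAlgType K).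
Notation n := (\dim {:L}).
Variables (e : n.-tuple L).
Hypothesis eB : basis_of {:L} e.
Implicit Types d : 'End(L).

Lemma mxof_entry d i j : mxof e e d i j = entry e d i j.
Proof. by rewrite /mxof mxE /= vecof_delta mxE. Qed.

Lemma entry_diagonal_part d i j :
  entry e (diagonal_part e d) i j = entry e d i i *+ (i == j).
Proof. by rewrite -mxof_entry /diagonal_part hommxK // 2!mxE mxof_entry. Qed.

Lemma diagonal_part_diagonal d : diagonal e (diagonal_part e d).
Proof. by move=> i j /negPf ij; rewrite entry_diagonal_part ij. Qed.

Variable T : {vspace 'End(L)}.
Hypothesis Td : forall t, t \in T -> diagonal e t.

Fact weight_is_linear i : linear (fun t : subvs_of T => (entry e (vsval t) i i : K^o)).
Proof. by move=> c s t; rewrite [vsval _]linearP entryD entryZ. Qed.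

Lemma weight_exists i :
  exists a : 'Hom(subvs_of T, K^o), forall t, a t = entry e (vsval t) i i.
Proof.
pose aux := GRing.isLinear.Build _ _ _ _ _ (weight_is_linear i).
pose a0 : {linear _ -> _} := HB.pack (fun t : subvs_of T => (entry e (vsval t) i i : K^o)) aux.
by exists (linfun a0) => t; rewrite lfunE.
Qed.

Lemma root_space_coord (w : 'I_n -> 'Hom(subvs_of T, K^o)) b x j :
  (forall i t, w i t = entry e (vsval t) i i) ->
  x \in root_space b -> w j != b -> coord e j x = 0.
Proof.
move=> wE /root_spaceP xb wb; apply/eqP; apply: contraNT wb => xj.
apply/eqP/lfunP => t; rewrite wE.
have := congr1 (coord e j) (xb t).
by rewrite (diagonal_coord eB j x (Td (subvsP t))) linearZ /= => /(mulIf xj).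
Qed.

Lemma basis_root_space (a : 'Hom(subvs_of T, K^o)) (i : 'I_n) :
  (forall t, a t = entry e (vsval t) i i) -> e`_i \in root_space a.
Proof.
by move=> aE; apply/root_spaceP => t; rewrite (diagonal_app eB i (Td (subvsP t))) aE.
Qed.

Lemma is_root_basis (a : 'Hom(subvs_of T, K^o)) (i : 'I_n) :
  e`_i \in root_space a -> is_root a.
Proof.
move=> h; apply/eqP => a0; move: h; rewrite a0 memv0; apply/negP.
by apply: (basis_not0 eB); apply: mem_nth; rewrite size_tuple.
Qed.

(** As e_i and e_j have the same weight, projecting [d e_i] to their root space keeps its
    coefficient on e_j, which the hypothesis forces to be zero. *)
Lemma off_diagonal_root d :
  (forall (a : 'Hom(subvs_of T, K^o)) (p : 'End(L)),
     is_root a -> is_root_proj a p -> forall i : 'I_n, e`_i \in root_space a ->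
     p (d e`_i) \in <[e`_i]>%VS) ->
  forall i j, i != j ->
  (forall t, t \in T -> entry e t i i = entry e t j j) -> entry e d i j = 0.
Proof.
move=> hd i j ij hij; have [w wE] := choice weight_exists.
have ei : e`_i \in root_space (w i) by apply: basis_root_space.
pose p := hommx e e (diag_mx (\row_k (w k == w i)%:R)).
have pE k l : entry e p k l = (w k == w i)%:R *+ (k == l).
  by rewrite -mxof_entry hommxK // !mxE.
have pd : diagonal e p by move=> k l /negPf kl; rewrite pE kl.
have pc k x : coord e k (p x) = (w k == w i)%:R * coord e k x.
  by rewrite (diagonal_coord eB) // pE eqxx mulr1n.
have pP : is_root_proj (w i) p.
  split=> [x xi | b bi x xb]; apply: (coordP eB) => k; rewrite pc.
    have [_ | ki] := eqVneq (w k) (w i); first by rewrite mul1r.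
    by rewrite (root_space_coord wE xi ki) mul0r.
  rewrite linear0; have [ki | _] := eqVneq (w k) (w i); last by rewrite mul0r.
  by rewrite (root_space_coord wE xb) ?mulr0 // ki eq_sym.
have wji : w j = w i by apply/lfunP => t; rewrite !wE hij // subvsP.
have /vlineP [c /(congr1 (coord e j))] := hd _ _ (is_root_basis ei) pP i ei.
by rewrite pc wji eqxx mul1r linearZ /= (coord_basisE eB) (negPf ij) mulr0.
Qed.

End DiagonalTorus.

(** Some derivation is non-nilpotent, so [derivation_split] carries the linear conditions from
    nil-independent derivations to all derivations. *)
Lemma d_locally_diagonalizableP (K : fieldType) (L : lieAlgType K) :
  [pchar K] =i pred0 -> ~ characteristically_nilpotent L ->
  d_locally_diagonalizable L ->
  exists (e : (\dim {:L}).-tuple L) (T : {vspace 'End(L)}),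
    maximal_torus T /\ triangular_torus e T.
Proof.
move=> K0 hchar [e [eB etri [T [Tmax [Tdiag Tmin] Toff T0]]]].
have [d0 [dd0 nd0]] : exists d0 : 'End(L), derivation d0 /\ ~ nilpotent_end d0.
  apply: contrapT => nex; apply: hchar => d dd; apply: contrapT => nd.
  by apply: nex; exists d.
(* Minimality of [T]: the diagonal maps form a subspace containing all the diagonal parts. *)
have Td t : t \in T -> diagonal e t.
  have [||U UP] := @pred_vspace _ _ (diagonal e).
  - by move=> i j _; rewrite /entry zero_lfunE linear0.
  - by move=> c x y hx hy i j ij; rewrite entryD entryZ hx // hy // mulr0 addr0.
  move=> tT; apply/UP; apply: (subvP (Tmin U _) _ tT) => d _.
  exact/UP/diagonal_part_diagonal.
have nil_ind := nonnilpotent_nil_independent.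
have band_nn d : derivation d -> ~ nilpotent_end d -> band e 0 d.
  move=> dd nd i j; rewrite addn0 => ij; rewrite -mxof_entry.
  by have /is_trig_mxP := etri d (nil_ind _ _ _ dd nd); apply.
have off_nn d : derivation d -> ~ nilpotent_end d -> forall i j, i != j ->
    (forall t, t \in T -> entry e t i i = entry e t j j) -> entry e d i j = 0.
  move=> dd nd; apply: (off_diagonal_root eB Td) => a p ra pa i.
  exact: Toff ra pa (nil_ind _ _ _ dd nd) i.
exists e, T; split=> //; split=> //; first by case: Tmax.
- move=> d dd; have [c [u [du nu ->]]] := derivation_split K0 dd0 nd0 dd.
  by apply: bandZ; apply: bandB; apply: band_nn.
- move=> d dd; have [c [u [du nu ->]]] := derivation_split K0 dd0 nd0 dd.
  exists (c *: (diagonal_part e u - diagonal_part e d0)) => [|i].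
    by apply: memvZ; apply: memvB; apply: Tdiag; apply: nil_ind.
  by rewrite !entryZ !entryB !entry_diagonal_part // eqxx !mulr1n.
- move=> d dd i j ij h; have [c [u [du nu ->]]] := derivation_split K0 dd0 nd0 dd.
  by rewrite entryZ entryB !(off_nn _ _ _ i j) // subrr mulr0.
(* If all of [T] killed e_i, then 0 would be a root. *)
move=> i; apply: contrapT => nex; apply: T0; apply: (is_root_basis eB (i := i)).
apply: (basis_root_space eB Td) => t; rewrite zero_lfunE.
apply/eqP; rewrite eq_sym; apply: contraT => ti; exfalso; apply: nex.
by exists (vsval t) => //; apply: subvsP.
Qed.

(** * Regular elements of the torus *)

Section Regular.
Variables (K : fieldType) (L : lieAlgType K) (n : nat) (e : n.-tuple L).
Variable T : {vspace 'End(L)}.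
Hypothesis K0 : [pchar K] =i pred0.
Hypothesis hT : triangular_torus e T.

Lemma regular_element : exists t0, [/\ t0 \in T, forall i, entry e t0 i i != 0
  & forall d, derivation d -> forall i j, i != j ->
      entry e t0 i i = entry e t0 j j -> entry e d i j = 0].
Proof.
(* The forms are the weights and their differences. Only those not identically zero on [T] are
   avoided; for a difference that vanishes on [T], [tt_off] gives the conclusion. *)
pose f (x : 'I_n + 'I_n * 'I_n) (t : 'End(L)) := match x with
  | inl i => entry e t i i
  | inr ij => entry e t ij.1 ij.1 - entry e t ij.2 ij.2
  end.
have [|x Px|t0 t0T h] := @avoid_hyperplanes _ K0 _ T _
    (fun x => exists2 t, t \in T & f x t != 0) f.
- move=> [i | [i j]] t c s /=; rewrite !entryD !entryZ // mulrBr.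
  by rewrite opprD addrACA.
- by [].
exists t0; split=> // [i | d dd i j ij].
  by apply: (h (inl i)); apply: (tt_root0 hT).
move=> /eqP; rewrite -subr_eq0 => /eqP tij.
apply: (tt_off hT dd ij) => t tT; apply/eqP; rewrite -subr_eq0.
apply: contraT => nt; have := h (inr (i, j)) (ex_intro2 _ _ t tT nt).
by rewrite /= tij eqxx.
Qed.

End Regular.

(** * Solvable extensions *)

Section Ideals.
Variables (K : fieldType) (R : lieAlgType K).
Implicit Types I J : {vspace R}.

Lemma lie_idealr I x y : lie_ideal I -> y \in I -> lie x y \in I.
Proof. by move=> hI yI; rewrite lieC memvN; apply: hI. Qed.

Lemma liev_ideal I : lie_ideal I -> lie_ideal (liev I I).
Proof.
move=> hI x y xI; suff le : (liev I I <= adr y @^-1: liev I I)%VS.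
  by have := subvP le _ xI; rewrite -memv_preim adrE.
apply: liev_sub => a b aI bI; rewrite -memv_preim adr_derivation !adrE.
by apply: memvD; apply: mem_liev => //; apply: hI.
Qed.

Lemma derived_ideal k : lie_ideal (derived {:R} k).
Proof. by elim: k => [x y _|k IHk]; [apply: memvf | apply: liev_ideal]. Qed.

End Ideals.

Section Extension.
Variables (K : fieldType) (N R : lieAlgType K) (f : 'Hom(N, R)).
Hypothesis f0 : lker f = 0%VS.
Hypothesis fM : {morph f : x y / lie x y >-> lie x y}.
Hypothesis fI : lie_ideal (limg f).

Lemma ext_inj : injective f.
Proof. by apply/lker0P/eqP. Qed.

(** The restriction of ad_x to the ideal [limg f], transported to [N]. The ideal property keeps its
    values in [limg f], where [f^-1] does invert [f]. *)
Definition rho (x : R) : 'End(N) := (f^-1 \o (adr x \o f))%VF.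

Lemma rhoE x a : f (rho x a) = lie (f a) x.
Proof. by rewrite !comp_lfunE adrE limg_lfunVK //; apply: fI; apply: memv_img (memvf a). Qed.

Lemma rho_uniq x (d : 'End(N)) : (forall a, f (d a) = lie (f a) x) -> rho x = d.
Proof. by move=> h; apply/lfunP => a; apply: ext_inj; rewrite h; apply: rhoE. Qed.

Lemma rho_is_linear : linear rho.
Proof.
move=> c x y; apply: rho_uniq => a.
by rewrite add_lfunE scale_lfunE linearP lieDr lieZr; congr (_ *: _ + _); apply: rhoE.
Qed.

Lemma rho_derivation x : derivation (rho x).
Proof.
move=> a b; apply: ext_inj; rewrite linearD /= !fM !rhoE !fM.
by have := adr_derivation x (f a) (f b); rewrite !adrE.
Qed.

(** Jacobi identity; the composites come in reverse order because [adr] brackets on the right. *)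
Lemma rho_lie x y : rho (lie x y) = ((rho y \o rho x) - (rho x \o rho y))%VF.
Proof.
apply: rho_uniq => a; rewrite add_lfunE opp_lfunE.
rewrite (comp_lfunE (rho y)) (comp_lfunE (rho x)) linearB /= !rhoE.
by have := adr_derivation y (f a) x; rewrite !adrE => ->; rewrite addrC addKr.
Qed.

Lemma rho_inner a : rho (f a) = adr a.
Proof. by apply: rho_uniq => b; rewrite adrE fM. Qed.

End Extension.

Section Triangular.
Variables (K : fieldType) (N : lieAlgType K) (e : (\dim {:N}).-tuple N).
Notation n := (\dim {:N}).
Variable T : {vspace 'End(N)}.
Hypothesis hT : triangular_torus e T.
Hypothesis Nnil : nilpotent_alg N.
Let eB := tt_basis hT.

Lemma band1_nilpotent d : derivation d -> nilpotent_end d -> band e 1 d.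
Proof.
move=> dd nd; have bd := tt_band hT dd.
by apply/band1_diag; split=> //; apply: (nilpotent_diag0 eB bd nd).
Qed.

Lemma adr_iter_lower_central (L : lieAlgType K) (J : {vspace L}) z k x :
  z \in J -> x \in J -> iter k (adr z) x \in lower_central J k.
Proof.
move=> zJ xJ; elim: k => [//|k IHk] /=.
by rewrite adrE; apply: mem_liev.
Qed.

Lemma band1_inner a : band e 1 (adr a).
Proof.
apply: band1_nilpotent; first exact: adr_derivation.
have [k lk] := Nnil; exists k => x; apply/eqP.
by rewrite -memv0 -lk; apply: adr_iter_lower_central; apply: memvf.
Qed.

Section Solvable.
Variables (R : lieAlgType K) (f : 'Hom(N, R)).
Hypothesis f0 : lker f = 0%VS.
Hypothesis fM : {morph f : x y / lie x y >-> lie x y}.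
Hypothesis fN : is_nilradical (limg f).
Hypothesis Rsolv : solvable_alg R.

Let fI : lie_ideal (limg f). Proof. by case: fN. Qed.
Let dr x : derivation (rho f x) := rho_derivation f0 fM fI x.

HB.instance Definition _ := GRing.isSemilinear.Build K R 'End(N) _ (rho f)
  (GRing.semilinear_linear (rho_is_linear f0 fI)).

(** Commutators of triangular maps have zero diagonal. With [band1_rhoP] this puts [R, R] inside the
    nilradical. *)
Lemma band1_rho_lie x y : band e 1 (rho f (lie x y)).
Proof.
by rewrite rho_lie //; apply: (band_comm1 eB); apply: (tt_band hT); apply: dr.
Qed.

Lemma band1_rho_limg x : x \in limg f -> band e 1 (rho f x).
Proof. by move=> /memv_imgP [a _ ->]; rewrite rho_inner //; apply: band1_inner. Qed.

(* The elements acting nilpotently on [N] form the nilradical.  Otherwise the last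
   term of the derived series that contains such elements outside [N] yields
   an ideal [J] with [J, J] in [N], strictly triangular on [N], hence
   nilpotent. *)
Lemma band1_rhoP x : band e 1 (rho f x) <-> x \in limg f.
Proof.
split; last exact: band1_rho_limg.
pose P k := forall y, y \in derived {:R} k -> band e 1 (rho f y) -> y \in limg f.
suff P0 : P 0%N by apply: P0; apply: memvf.
have [k Rk] := Rsolv.
have : P k by move=> y; rewrite Rk memv0 => /eqP -> _; apply: mem0v.
elim: k {Rk} => // k IHk PS; apply: IHk.
have [||U UP] := @pred_vspace _ _ (fun y => y \in derived {:R} k /\ band e 1 (rho f y)).
- by split; [apply: mem0v | rewrite linear0; apply: band0].
- move=> c y z [yk by_] [zk bz]; split; first by apply: memvD => //; apply: memvZ.
  by rewrite linearP; apply: bandD => //; apply: bandZ.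
pose J := (limg f + U)%VS.
have bJ y : y \in J -> band e 1 (rho f y).
  move=> /memv_addP [a /band1_rho_limg ba [b /UP [_ bb] ->]].
  by rewrite linearD; apply: bandD.
have Jideal : lie_ideal J.
  move=> y z /memv_addP [a aN [b /UP [bk _] ->]]; rewrite lieDl; apply: memv_add.
    exact: fI.
  by apply/UP; split; [apply: derived_ideal | apply: band1_rho_lie].
have JJ y z : y \in J -> z \in J -> lie y z \in limg f.
  move=> /memv_addP [a aN [b /UP [bk _] ->]] /memv_addP [c cN [d /UP [dk _] ->]].
  rewrite lieDl lieDr (lieDr b); apply: memvD; first by apply: memvD; apply: fI.
  apply: memvD; first exact: lie_idealr.
  by apply: PS; [apply: mem_liev | apply: band1_rho_lie].
(* The first bracket lands in [N] and each later one goes down one flag, whence the exponent [n.+1]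
   below. *)
have lowJ j : (lower_central J j.+1 <= f @: flag e (n - j))%VS.
  elim: j => [|j IHj]; last first.
    apply: liev_sub => y z /(subvP IHj) /memv_imgP [v vl ->] zJ.
    rewrite -(rhoE fI); apply: memv_img; rewrite subnS -subn1.
    exact: (proj1 (band_flagP eB 1 _) (bJ _ zJ)).
  by rewrite subn0 (flagT eB) //; apply: liev_sub.
have Jnil : nilpotent_sub J.
  by exists n.+1; apply/eqP; rewrite -subv0 -(limg0 f) -(flag0 e) -(subnn n).
have [_ _ /(_ J Jideal Jnil) JN] := fN.
move=> y yk byy; apply: (subvP JN); apply: (subvP (addvSr _ _)).
exact/UP.
Qed.

Definition diag_row (d : 'End(N)) : 'rV[K]_n := \row_i entry e d i i.
Fact diag_row_is_linear : linear diag_row.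
Proof. by move=> c d u; apply/rowP => i; rewrite !mxE entryD entryZ. Qed.
HB.instance Definition _ := GRing.isSemilinear.Build K 'End(N) 'rV[K]_n _ diag_row
  (GRing.semilinear_linear diag_row_is_linear).

(** The diagonal of ad_x on [N]. Its kernel is the nilradical and its image consists of diagonals of
    elements of [T], so the codimension of [N] is at most [\dim T]. *)
Let Delta : 'Hom(R, 'rV[K]_n) := linfun (diag_row \o rho f).
Let D : 'Hom('End(N), 'rV[K]_n) := linfun diag_row.

Let lkerDelta : lker Delta = limg f.
Proof.
apply/vspaceP => x; rewrite memv_ker lfunE /=; apply/eqP/idP => [/rowP h | /band1_rhoP].
  apply/band1_rhoP/band1_diag; split=> [|i]; first exact/(tt_band hT).
  by have := h i; rewrite !mxE.
by move=> /band1_diag [_ h]; apply/rowP => i; rewrite !mxE h.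
Qed.

Let limgDelta : (limg Delta <= D @: T)%VS.
Proof.
apply/subvP => _ /memv_imgP [x _ ->]; have [t tT tE] := tt_diag hT (dr x).
apply/memv_imgP; exists t => //; rewrite !lfunE /=.
by apply/rowP => i; rewrite !mxE tE.
Qed.

Let dimR : \dim {:R} = (n + \dim (limg Delta))%N.
Proof.
rewrite -(limg_ker_dim Delta fullv) capfv lkerDelta limg_dim_eq // f0 capv0 //.
Qed.

Let dimDT : (\dim (D @: T) <= \dim T)%N.
Proof. by rewrite -(limg_ker_dim D T) leq_addl. Qed.

Lemma dim_extension : (\dim {:R} <= n + \dim T)%N.
Proof. by rewrite dimR leq_add2l (leq_trans (dimvS limgDelta)). Qed.

(** At the largest possible dimension, [Delta] must reach every diagonal of [T]. *)
Lemma diag_rho_onto t : (n + \dim T <= \dim {:R})%N -> t \in T ->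
  exists x, forall i, entry e (rho f x) i i = entry e t i i.
Proof.
rewrite dimR leq_add2l => dT tT.
have /eqP E : limg Delta == (D @: T)%VS.
  by rewrite eqEdim limgDelta (leq_trans dimDT).
have : D t \in limg Delta by rewrite E memv_img.
move=> /memv_imgP [x _ /rowP h]; exists x => i.
by have := h i; rewrite !lfunE /= !mxE.
Qed.

(** * The centralizer of an element acting as a regular element of the torus *)

Variable t0 : 'End(N).
Hypothesis t0T : t0 \in T.
Hypothesis t0n0 : forall i, entry e t0 i i != 0.
Hypothesis t0sep : forall d, derivation d -> forall i j, i != j ->
  entry e t0 i i = entry e t0 j j -> entry e d i j = 0.
Variable x : R.
Hypothesis xt0 : rho f x = t0.
Hypothesis Rdim : (n + \dim T <= \dim {:R})%N.

Let Q := lker (adr x).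

Let QE y : (y \in Q) = (lie y x == 0).
Proof. by rewrite memv_ker adrE. Qed.

(** On [N], [x] acts as [t0], which has no zero eigenvalue. *)
Let QN y : y \in Q -> y \in limg f -> y = 0.
Proof.
rewrite QE => /eqP yx /memv_imgP [a _ ya]; move: yx; rewrite ya -(rhoE fI) xt0.
move/eqP; rewrite -memv_ker f0 memv0 => /eqP t0a.
suff -> : a = 0 by rewrite linear0.
apply: (coordP eB) => i; apply: (mulfI (t0n0 i)).
by rewrite -(diagonal_coord eB) ?t0a ?linear0 ?mulr0 //; apply: (tt_diagonal hT).
Qed.

(** Take [t] in [T] with the diagonal of [rho f y]. The difference is a strictly triangular
    derivation commuting with [t0], hence zero by [ad_inj]. *)
Let rhoQ y : y \in Q -> rho f y \in T.
Proof.
rewrite QE => /eqP yx; have [t tT tE] := tt_diag hT (dr y).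
have [Tder Tcom _] := tt_torus hT.
suff /eqP : rho f y - t = 0 by rewrite subr_eq0 => /eqP ->.
apply: (@ad_inj _ _ _ _ eB t0 _ _ 1) => //.
- exact: (tt_diagonal hT).
- by apply: derivationB; [apply: dr | apply: Tder].
- apply/band1_diag; split=> [|i]; last by rewrite entryB tE subrr.
  by apply: (tt_band hT); apply: derivationB; [apply: dr | apply: Tder].
rewrite comp_lfunDr comp_lfunDl comp_lfunNr comp_lfunNl (Tcom t0 t) //.
rewrite opprD opprK addrACA addNr addr0 -xt0 -rho_lie // yx linear0 //.
Qed.

(** Dimension count: [adr x] maps [R] into [N], so [Q] has dimension at least [\dim T], and [rho f]
    is injective on [Q]. *)
Let limg_rhoQ : (linfun (rho f) @: Q)%VS = T.
Proof.
apply/eqP; rewrite eqEdim; apply/andP; split.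
  by apply/subvP => _ /memv_imgP [y yQ ->]; rewrite lfunE; apply: rhoQ.
rewrite limg_dim_eq; last first.
  apply/eqP; rewrite -subv0; apply/subvP => y; rewrite memv_cap memv_ker lfunE memv0.
  move=> /andP [yQ /eqP y0]; apply/eqP; apply: QN => //; apply/band1_rhoP.
  by rewrite y0; apply: band0.
rewrite -(leq_add2l n) (leq_trans Rdim) //.
rewrite -(limg_ker_dim (adr x) fullv) capfv addnC leq_add2r.
have -> : n = \dim (limg f) by rewrite limg_dim_eq // f0 capv0.
apply: dimvS; apply/subvP => _ /memv_imgP [y _ ->].
by apply/band1_rhoP; rewrite adrE; apply: band1_rho_lie.
Qed.

(** The bracket lies in [Q] because [adr x] is a derivation, and in [N] because every bracket
    does. *)
Let QQ y z : y \in Q -> z \in Q -> lie y z = 0.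
Proof.
move=> yQ zQ; apply: QN; last by apply/band1_rhoP; apply: band1_rho_lie.
move: yQ zQ; rewrite !memv_ker adr_derivation => /eqP -> /eqP ->.
by rewrite lie0l lie0r addr0.
Qed.

Lemma torus_ext_iso (hT' : is_torus T) : lie_iso (torus_ext hT') R.
Proof.
have sec (t : subvs_of T) : exists y, y \in Q /\ rho f y = vsval t.
  have /memv_imgP [y yQ yt] : vsval t \in (linfun (rho f) @: Q)%VS.
    by rewrite limg_rhoQ subvsP.
  by exists y; rewrite yt lfunE.
have [s sP] := choice sec.
have sQ t : s t \in Q by case: (sP t).
have sE t : rho f (s t) = vsval t by case: (sP t).
(* Uniqueness of the preimage in [Q] makes the chosen section [s] linear. *)
have Quniq y t : y \in Q -> rho f y = vsval t -> y = s t.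
  move=> yQ yt; apply/eqP; rewrite -subr_eq0; apply/eqP/QN.
    by rewrite memvB.
  by apply/band1_rhoP; rewrite linearB /= yt sE subrr; apply: band0.
pose F (u : torus_ext hT') : R := f u.1 + s u.2.
have Flin : linear F.
  move=> c u v; rewrite /F linearP /= -(Quniq (c *: s u.2 + s v.2)).
  - by rewrite scalerDr addrACA.
  - by apply: memvD => //; apply: memvZ.
  by rewrite linearP /= !sE.
pose aux := GRing.isLinear.Build _ _ _ _ _ Flin.
pose Fl : {linear _ -> _} := HB.pack F aux.
have Finj : injective F.
  move=> u v /eqP; rewrite -subr_eq0 -[F u - F v](linearB Fl) /=.
  move: (u - v) (subr_eq0 u v) => w wE /eqP Fw; apply/eqP; rewrite -wE.
  have /eqP := Fw; rewrite /F addr_eq0 => /eqP fs.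
  have s0 : s w.2 = 0.
    apply: QN => //; rewrite -memvN -fs; exact: memv_img (memvf _).
  have w2 : w.2 = 0.
    by apply: val_inj; rewrite /= -sE s0 linear0.
  have w1 : w.1 = 0 by apply: (ext_inj f0); rewrite fs s0 oppr0 linear0.
  by apply/eqP; case: w w1 w2 {wE Fw fs s0} => ? ? /= -> ->.
have Fsurj y : exists u, F u = y.
  (* Removing the element of [Q] with the same diagonal leaves a strictly triangular action, that
     is, an element of [N]. *)
  have [t tT tE] := tt_diag hT (dr y).
  have : y - s (Subvs tT) \in limg f.
    apply/band1_rhoP; rewrite linearB /= sE /=; apply/band1_diag.
    split=> [|i]; last by rewrite entryB tE subrr.
    by apply: bandB; [apply: (tt_band hT) | apply/diagonal_band/(tt_diagonal hT)].
  by move=> /memv_imgP [a _ aE]; exists (a, Subvs tT); rewrite /F /= -aE subrK.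
have [G GK] := choice Fsurj.
exists Fl; split; first by exists G => [u | y]; [apply: Finj; rewrite GK | rewrite /= GK].
move=> u v; rewrite /= /F /=.
have -> : s 0 = 0 by rewrite -(Quniq 0 0) ?mem0v // linear0.
rewrite lieDl !(lieDr _ (f v.1)) (QQ (sQ _) (sQ _)) !addr0 -fM -!rhoE //.
by rewrite (lieC (s u.2)) -rhoE // !sE linearB linearD.
Qed.

End Solvable.
End Triangular.

(** * The semidirect product *)

Section SemidirectProduct.
Variables (K : fieldType) (N : lieAlgType K) (e : (\dim {:N}).-tuple N).
Variable T : {vspace 'End(N)}.
Hypothesis hT : triangular_torus e T.
Hypothesis Nnil : nilpotent_alg N.
Variable hT' : is_torus T.
Notation M := (torus_ext hT').

Definition torus_ext_inj (a : N) : M := (a, 0).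
Fact torus_ext_inj_is_linear : linear torus_ext_inj.
Proof. by move=> c a b; congr pair; rewrite /= scaler0 addr0. Qed.
HB.instance Definition _ := GRing.isSemilinear.Build K N M _ torus_ext_inj
  (GRing.semilinear_linear torus_ext_inj_is_linear).
Let f : 'Hom(N, M) := linfun torus_ext_inj.

Let fE a : f a = torus_ext_inj a.
Proof. by rewrite lfunE. Qed.

Let f0 : lker f = 0%VS.
Proof. by apply/eqP/lker0P => a b; rewrite !fE => -[]. Qed.

Let fM : {morph f : x y / lie x y >-> lie x y}.
Proof.
move=> a b; rewrite !fE; congr pair.
by rewrite /= !zero_lfunE addr0 subr0.
Qed.

Let fP (z : M) : (z \in limg f) = (z.2 == 0).
Proof.
apply/memv_imgP/eqP => [[a _ ->] | z0]; first by rewrite fE.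
by exists z.1; rewrite ?memvf // fE; case: z z0 => a t /= ->.
Qed.

Let lie_fN (x y : M) : lie x y \in limg f.
Proof. by rewrite fP. Qed.

Lemma torus_ext_solvable : solvable_alg M.
Proof.
(* One bracket leads into [N]; from there the derived series is bounded by the lower central series
   of [N]. *)
have [k Nk] := Nnil; exists k.+1; apply/eqP.
rewrite -subv0 -(limg0 f) -Nk; elim: k {Nk} => [|k IHk].
  by apply: liev_sub => x y _ _; apply: lie_fN.
apply: liev_sub => x y /(subvP IHk) /memv_imgP [a ak ->] /(subvP IHk) /memv_imgP [b _ ->].
by rewrite -fM; apply/memv_img/mem_liev => //; apply: memvf.
Qed.

(** If [(a, t)] lies in a nilpotent ideal, it acts on [N] by the nilpotent derivation ad_a + t.
    Since ad_a has zero diagonal, so has [t], and [t = 0]. *)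
Lemma torus_ext_nilradical : is_nilradical (limg f).
Proof.
split=> [x y _||J Ji Jn]; first exact: lie_fN.
  have [k Nk] := Nnil; exists k; apply/eqP.
  rewrite -subv0 -(limg0 f) -Nk; elim: k {Nk} => [|k IHk] //.
  apply: liev_sub => x y /(subvP IHk) /memv_imgP [a ak ->] /memv_imgP [b _ ->].
  by rewrite -fM; apply/memv_img/mem_liev => //; apply: memvf.
apply/subvP => -[a t] zJ; rewrite fP /=; apply/eqP/val_inj.
have [Tder _ _] := hT'; have tT := subvsP t.
pose d : 'End(N) := adr a + vsval t.
have dd : derivation d by apply: derivationD; [apply: adr_derivation | apply: Tder].
have itE m b : iter m (adr ((a, t) : M)) (f b) = f (iter m d b).
  elim: m => // m IHm; rewrite !iterS IHm adrE !fE; congr pair.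
  by rewrite /= zero_lfunE subr0 add_lfunE adrE.
have nd : nilpotent_end d.
  (* The additional application of [adr] brings [f b] into [J]. *)
  have [k Jk] := Jn; exists k.+1 => b; apply/eqP.
  rewrite -memv0 -f0 memv_ker -itE iterSr -memv0 -Jk.
  by apply: adr_iter_lower_central => //; rewrite adrE; apply: lie_idealr.
have [_ d0] := proj1 (band1_diag e d) (band1_nilpotent hT dd nd).
have [_ a0] := proj1 (band1_diag e _) (band1_inner hT Nnil a).
apply: (diagonalP (tt_basis hT)) => [||i]; first exact: (tt_diagonal hT).
  by move=> i j _; rewrite /= /entry zero_lfunE linear0.
by have := d0 i; rewrite entryD a0 add0r => ->; rewrite /entry zero_lfunE linear0.
Qed.

Lemma torus_ext_solvable_extension :
  ~ characteristically_nilpotent N -> solvable_extension N M.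
Proof.
move=> hchar; split; first exact: torus_ext_solvable.
  (* A nilpotent [M] would equal its nilradical, forcing [T = 0]; all derivations would then have
     zero diagonal. *)
  move=> Mnil; apply: hchar => d dd; exists (\dim {:N}) => x.
  have [_ _ /(_ fullv) max] := torus_ext_nilradical.
  have {}max : (fullv <= limg f)%VS by apply: max => // ? ? _; apply: memvf.
  apply: (band1_iter (tt_basis hT)); apply/band1_diag.
  split=> [|i]; first exact: (tt_band hT).
  have [t tT <-] := tt_diag hT dd.
  have := subvP max ((0, Subvs tT) : M) (memvf _); rewrite fP => /eqP /(congr1 val) /= ->.
  by rewrite /entry zero_lfunE linear0.
by exists f; split=> //; apply: torus_ext_nilradical.
Qed.

Lemma dim_torus_ext : \dim {:M} = (\dim {:N} + \dim T)%N.
Proof. by rewrite !dimvf. Qed.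

End SemidirectProduct.

(** * Existence and uniqueness of the maximal extension *)

Lemma torus_ext_maximal (K : fieldType) (N : lieAlgType K)
    (e : (\dim {:N}).-tuple N) (T : {vspace 'End(N)}) (hT' : is_torus T) :
  nilpotent_alg N -> ~ characteristically_nilpotent N -> triangular_torus e T ->
  maximal_solvable_extension N (torus_ext hT').
Proof.
move=> Nnil hchar hT; split; first exact: torus_ext_solvable_extension hT _ _ _.
move=> R [Rs _ [f [f0 fM fN]]]; rewrite dim_torus_ext.
exact: (dim_extension hT Nnil f0 fM fN Rs).
Qed.

Lemma maximal_extension_iso (K : fieldType) (N : lieAlgType K)
    (e : (\dim {:N}).-tuple N) (T : {vspace 'End(N)}) (hT' : is_torus T)
    (R : lieAlgType K) :
  [pchar K] =i pred0 -> nilpotent_alg N -> ~ characteristically_nilpotent N ->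
  triangular_torus e T -> maximal_solvable_extension N R ->
  lie_iso (torus_ext hT') R.
Proof.
move=> K0 Nnil hchar hT [[Rs _ [f [f0 fM fN]]] Rmax].
(* Comparison with the semidirect product gives the lower bound on [\dim {:R}]. *)
have Rdim := Rmax _ (torus_ext_solvable_extension hT Nnil hT' hchar).
rewrite dim_torus_ext in Rdim.
have [t0 [t0T t0n0 t0sep]] := regular_element K0 hT.
have eB := tt_basis hT.
have [x xt0] := diag_rho_onto hT Nnil f0 fM fN Rs Rdim t0T.
have fI : lie_ideal (limg f) by case: fN.
have dx := rho_derivation f0 fM fI x.
have [Tder _ _] := hT'.
have dt0 := Tder _ t0T.
have b1 : band e 1 (rho f x - t0).
  apply/band1_diag; split=> [|i]; last by rewrite entryB xt0 subrr.
  by apply: (tt_band hT); apply: derivationB.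
have [g gA gE] := diag_conj K0 eB dt0 (tt_diagonal hT t0T) t0sep (ltn0Sn 0) dx b1.
have [k0 gM] := gA; have [_ gVM] := lie_aut_inv gA.
(* Instead of changing [x], the embedding of [N] is twisted by the automorphism [g]; through [h],
   [x] acts on [N] exactly as [t0]. *)
pose h := (f \o g^-1)%VF.
have hf : limg h = limg f by rewrite limg_comp (lker0_limgf (lie_aut_inv gA).1).
have h0 : lker h = 0%VS.
  apply/eqP/lker0P => a b; rewrite !comp_lfunE => /(ext_inj f0).
  by apply: (can_inj (lker0_lfunVK k0)).
have hM : {morph h : a b / lie a b >-> lie a b}.
  by move=> a b; rewrite !comp_lfunE gVM fM.
have hN : is_nilradical (limg h) by rewrite hf.
have hI : lie_ideal (limg h) by case: hN.
apply: (torus_ext_iso hT Nnil h0 hM hN Rs t0T t0n0 t0sep (x := x) _ Rdim).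
apply: (rho_uniq h0 hI) => a.
rewrite /h !comp_lfunE -(rhoE fI); congr (f _).
apply: (can_inj (lker0_lfunK k0)); rewrite (lker0_lfunVK k0).
by rewrite -[g _]comp_lfunE gE comp_lfunE (lker0_lfunVK k0).
Qed.

Theorem theorem3p10 (R : realType) (N : lieAlgType R[i])
    (hnil : nilpotent_alg N)
    (hchar : ~ characteristically_nilpotent N)
    (hdiag : d_locally_diagonalizable N) :
  exists M : lieAlgType R[i],
    [/\ maximal_solvable_extension N M,
        forall M' : lieAlgType R[i],
          maximal_solvable_extension N M' -> lie_iso M M'
      & exists (T : {vspace 'End(N)}) (hT : is_torus T),
          maximal_torus T /\ lie_iso M (torus_ext hT)].
Proof.
have K0 : [pchar R[i]] =i pred0 by exact: Num.Theory.pchar_num.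
have [e [T [Tmax hT]]] := d_locally_diagonalizableP K0 hchar hdiag.
have [Ttor _] := Tmax.
exists (torus_ext Ttor); split; first exact: torus_ext_maximal hT.
  by move=> M'; apply: maximal_extension_iso hT.
exists T, Ttor; split=> //; exists idfun; split=> //.
by exists idfun.
Qed.
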